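(* Let $p\geq 2$ and $s\geq 2$ be integers (with $p$ not necessarily prime), let $q = p^{2^{s-1}}$, $e_1 = p^2 + p + 1$, and $e_i = p^{2^{i-1}} - p^{2^{i-2}} + 1$ for $2 \leq i \leq s$, and let $c_i=\prod_{j=1}^i e_j$ for $1\le i\le s$. Let $\mathscr{P} = \prod_{i=1}^s \mathbb{Z}_{e_i}$, let $G = S_{e_1} \wr \ldots \wr S_{e_s}\leq \mathrm{Sym}(\mathscr{P})$, and let $\mathscr{D}^s = (\mathscr{P},\mathscr{B})$ with $\mathscr{B} = B_s^G=\{B_s^g\mid g\in G\}$, where $$B_s := \big\{ (\delta_1,0,\ldots,0) \in \mathscr{P} \ \big|\ 0 \leq \delta_1 \leq p \big\} \cup \bigcup_{\ell=2}^s \big\{ (\underbrace{0,\ldots,0}_{\ell-1}, \delta_\ell, 0,\ldots,0) \in \mathscr{P} \ \big|\ \delta_\ell \in \mathbb{Z}_{e_\ell}\setminus\{0\} \big\}.$$ Then $\mathscr{D}^s$ is a $2$-$(v,k,\lambda)$ design with $v = q^2 + q + 1$, $k = q+1$, and $$\lambda = \binom{e_1-1}{p} \cdot \frac{1}{p+1} \cdot \prod_{i=2}^s (c_{i-1})^{e_i-1};$$ $\mathscr{D}^s$ is not a $3$-design; and $G \leq \mathrm{Aut}(\mathscr{D}^s)$ is block-transitive and $s$-chain-imprimitive, but not flag-transitive.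
   Context: A $t$-$(v,k,\lambda)$ design (briefly, a $t$-design) is a pair $\mathscr{D}=(\mathscr{P},\mathscr{B})$ with $\mathscr{P}$ a set of $v$ points and $\mathscr{B}$ a set of $k$-element subsets of $\mathscr{P}$ (blocks), such that every set of $t$ distinct points is contained in exactly $\lambda$ blocks. A flag is a pair $(a,B)\in\mathscr{P}\times\mathscr{B}$ with $a\in B$. An automorphism is a permutation of $\mathscr{P}$ preserving $\mathscr{B}$. A group $G\leq \mathrm{Aut}(\mathscr{D})$ is block-transitive (flag-transitive) if it is transitive on $\mathscr{B}$ (on the set of flags). For $0\le i\le s$ let $\mathscr{C}_i$ be the partition of $\mathscr{P}=\prod_{i=1}^s\mathbb{Z}_{e_i}$ in which two points $(\varepsilon_1,\dots,\varepsilon_s)$ and $(\delta_1,\dots,\delta_s)$ lie in the same class if and only if $\varepsilon_j=\delta_j$ for all $j>i$ (so $\mathscr{C}_0$ is the partition into singletons and $\mathscr{C}_s=\{\mathscr{P}\}$). The iterated wreath product $G=S_{e_1}\wr\ldots\wr S_{e_s}$ is the group of all permutations of $\mathscr{P}$ leaving each $\mathscr{C}_i$ invariant. For partitions of $\mathscr{P}$, $\mathscr{C}'\prec\mathscr{C}$ means that each part of $\mathscr{C}'$ is a subset of some part of $\mathscr{C}$ with at least one inclusion proper. A group $G\leq\mathrm{Sym}(\mathscr{P})$ is $s$-chain-imprimitive on $\mathscr{P}$ if $G$ is transitive on $\mathscr{P}$ and there exist $G$-invariant partitions $\mathscr{C}_0\prec\mathscr{C}_1\prec\cdots\prec\mathscr{C}_s$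 of $\mathscr{P}$ with $\mathscr{C}_0$ the partition into singletons and $\mathscr{C}_s=\{\mathscr{P}\}$. *)

(* Defs.v *)
From HB Require Import structures.
From mathcomp Require Import all_boot all_order all_algebra all_fingroup.

Set Implicit Arguments.
Unset Strict Implicit.
Unset Printing Implicit Defensive.

Import GRing.Theory.
Local Open Scope group_scope.
Local Open Scope nat_scope.

Section Designs.

(* The point set of a design is the whole finite type T; a design on T is given
   by its set of blocks. *)
Variable T : finType.
Implicit Types (B C : {set {set T}}) (G : {set {perm T}}).

Definition is_design (t v k lambda : nat) B : Prop :=
  [/\ #|T| = v,
      forall b : {set T}, b \in B -> #|b| = k
    & forall S : {set T}, #|S| = t -> #|[set b in B | S \subset b]| = lambda].

Definition is_t_design (t : nat) B : Prop :=
  exists v k lambda : nat, is_design t v k lambda B.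

(* 'P^* is the action of permutations on subsets of T by taking images, so
   'N(B | 'P^* ) consists of the permutations sending blocks to blocks. *)
Definition design_aut B : {set {perm T}} := 'N(B | 'P^*).
Canonical design_aut_group B := Eval hnf in [group of design_aut B].

Definition flags B : {set T * {set T}} :=
  [set f | (f.2 \in B) && (f.1 \in f.2)].

Definition flag_act (f : T * {set T}) (g : {perm T}) : T * {set T} :=
  (g f.1, g @: f.2).

Lemma flag_act1 : flag_act^~ 1%g =1 id.
Proof.
case=> x b; rewrite /flag_act /= perm1; congr (_, _).
by rewrite -[RHS]imset_id; apply: eq_imset => y; rewrite perm1.
Qed.

Lemma flag_actM f : act_morph flag_act f.
Proof.
case: f => x b g h; rewrite /flag_act /= permM; congr (_, _).
by rewrite -imset_comp; apply: eq_imset => y; rewrite /= permM.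
Qed.

Canonical flag_action : {action {perm T} &-> T * {set T}} :=
  TotalAction flag_act1 flag_actM.

Definition block_transitive G B : bool := [transitive G, on B | 'P^*].

Definition flag_transitive G B : bool :=
  [transitive G, on flags B | flag_action].

Definition invariant_partition G C : bool :=
  partition C [set: T] && [acts G, on C | 'P^*].

Definition strictly_finer C' C : Prop :=
  (forall A : {set T}, A \in C' -> exists2 A' : {set T}, A' \in C & A \subset A')
  /\ (exists A A' : {set T}, [/\ A \in C', A' \in C & A \proper A']).

Definition chain_imprimitive (s : nat) G : Prop :=
  [transitive G, on [set: T] | 'P] /\
  exists C : nat -> {set {set T}},
    [/\ forall i, i <= s -> invariant_partition G (C i),
        forall i, i < s -> strictly_finer (C i) (C i.+1),
        C 0 = [set [set x] | x : T]
      & C s = [set [set: T]]].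

End Designs.

Section IteratedWreath.

(* The factors e_1, ..., e_s are given by a function on nat, used from 1 on, so
   coordinate i : 'I_s is the (i+1)-st coordinate. 'Z_n is the ring of integers
   modulo n only for n > 1, so all the e_i should be at least 2. *)
Variables (e : nat -> nat) (s : nat).

Definition point := {dffun forall i : 'I_s, 'Z_(e i.+1)}.

(* The condition "j > i" on the 1-based coordinate j reads "i <= j" on the
   0-based one. *)
Definition level_partition (i : nat) : {set {set point}} :=
  equivalence_partition
    (fun x y : point => [forall j : 'I_s, (i <= j) ==> (x j == y j)])
    [set: point].

Definition iterated_wreath : {set {perm point}} :=
  \bigcap_(i < s.+1) 'N(level_partition i | 'P^*).
Canonical iterated_wreath_group := Eval hnf in [group of iterated_wreath].

Definition axis_point (l : 'I_s) (d : 'Z_(e l.+1)) : point :=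
  finfun (dfwith (fun j : 'I_s => 0%R : 'Z_(e j.+1)) d).

(* The first union has the single index l = 0. *)
Definition base_block (p : nat) : {set point} :=
  (\bigcup_(l < s | l == 0 :> nat)
     [set axis_point d | d : 'Z_(e l.+1) & d <= p]) :|:
  (\bigcup_(l < s | 0 < l)
     [set axis_point d | d : 'Z_(e l.+1) & d != 0%R]).

Definition base_block_orbit (p : nat) : {set {set point}} :=
  orbit 'P^* iterated_wreath (base_block p).

End IteratedWreath.

(* Only the indices i >= 1 are meaningful. *)
Definition factor (p i : nat) : nat :=
  if i == 1 then p ^ 2 + p + 1
  else p ^ (2 ^ (i - 1)) - p ^ (2 ^ (i - 2)) + 1.

Definition class_size (p i : nat) : nat := \prod_(1 <= j < i.+1) factor p j.

(* Main.v *)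
Require Import Defs.
From mathcomp Require Import all_boot all_order all_algebra all_fingroup.
From mathcomp Require Import zify ring.

Set Implicit Arguments.
Unset Strict Implicit.
Unset Printing Implicit Defensive.

Import GRing.Theory.

(* The group is transitive on the ordered pairs of points that differ in
   coordinate i and agree above it, for each i.  By double counting, B is then a
   2-design as soon as the fraction of such pairs lying in B_s is the same for
   all i.  Writing B_i for the part of B_s in the class of the origin in C_i, the
   points of B_s outside B_i lie in distinct classes of C_i, so the number of
   pairs of B_s agreeing above i is |B_i|^2 + |B_s| - |B_i|, which turns out to be
   c_i + q: every level gives the same fraction, and lambda = |B| / v.

   The size of B comes from the orbits of the B_i: the stabiliser of B_i+1 is
   contained in that of B_i, and the stabiliser of B_i maps B_i+1 onto B_i
   together with any transversal of the other classes of C_i in that class of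
   C_i+1.  The orbit of B_1 consists of the (p+1)-subsets of classes of C_1.

   A block meets a class of C_1 in 0, 1 or p + 1 points, which rules out
   flag-transitivity; if B were a 3-design, counting the third point of triples
   through two points of the same class of C_1, once inside that class and once
   in the whole set, would give two incompatible ratios. *)

(** * Finite sets and double counting *)

Section FiniteSets.

Variable T : finType.

(** Induction on the size of [A :\: B]: a transposition exchanging a point of [A :\: B] with one of
    [B :\: A] makes the difference smaller. *)
Lemma perm_imset_ex (A B : {set T}) :
  #|A| = #|B| -> exists g : {perm T}, g @: A = B.
Proof.
move: {2}_.+1 (ltnSn #|A :\: B|) => n; elim: n A => // n IHn A ltAn eqAB.
have [/eqP AB0 | [x xAB]] := set_0Vmem (A :\: B).
  exists 1%g; rewrite (eq_imset (g := id)) ?imset_id; last by move=> x; rewrite perm1.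
  by apply/eqP; rewrite eqEcard -setD_eq0 AB0 eqAB leqnn.
have [/eqP BA0 | [y yBA]] := set_0Vmem (B :\: A).
  have /eqP eAB : B == A by rewrite eqEcard -setD_eq0 BA0 eqAB leqnn.
  by rewrite eAB setDv inE in xAB.
case/setDP: xAB => xA xB; case/setDP: yBA => yB yA.
have AD z : z \in tperm x y @: A :\: B -> z \in (A :\: B) :\ x.
  rewrite !inE => /andP[zB /imsetP[t tA zt]].
  move: zB; rewrite {z}zt; case: tpermP => [_|ty|/eqP tx /eqP ty] tB.
  - by rewrite yB in tB.
  - by rewrite ty (negPf yA) in tA.
  - by rewrite tx tB.
have ltD : #|tperm x y @: A :\: B| < n.
  rewrite -ltnS; apply: leq_trans ltAn; rewrite ltnS (cardsD1 x (A :\: B)) inE xA xB add1n ltnS.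
  by apply: subset_leq_card; apply/subsetP.
have [|g gAB] := IHn _ ltD; first by rewrite card_imset //; exact: perm_inj.
exists (tperm x y * g)%g; rewrite -gAB -imset_comp.
by apply: eq_imset => z; rewrite /= permM.
Qed.

Lemma setact_imset (g : {perm T}) (A : {set T}) : 'P^*%act A g = g @: A.
Proof. by []. Qed.

End FiniteSets.

Lemma double_count (T U : finType) (A : {set T}) (B : {set U}) (r : T -> U -> bool) :
  \sum_(x in A) #|[set y in B | r x y]| = \sum_(y in B) #|[set x in A | r x y]|.
Proof.
rewrite (eq_bigr (fun x => \sum_(y in B | r x y) 1)) => [|x _]; last by rewrite sum1dep_card.
rewrite (exchange_big_dep (mem B)) /= => [|x y _ /andP[]//].
by apply: eq_bigr => y yB; rewrite yB /= sum1dep_card.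
Qed.

Lemma card_pairs (T : finType) (P : pred T) (Q : rel T) :
  #|[set u : T * T | P u.1 && Q u.1 u.2]| = \sum_(x | P x) #|[set y | Q x y]|.
Proof.
rewrite -sum1dep_card (eq_bigr (fun x => \sum_(y | Q x y) 1)) => [|x _].
  by rewrite pair_big_dep.
by rewrite sum1dep_card.
Qed.

(** Double counting of the pairs [(x, b)] with [x] in [D :\: S] and [b] a block through [S] and [x].
    It is applied with [D] the whole point set and with [D] a class of C_1. *)
Lemma design3_count (T : finType) (B : {set {set T}}) (S D : {set T}) (m lambda : nat) :
    #|S| = 2 -> S \subset D ->
    (forall S3 : {set T}, #|S3| = 3 -> #|[set b in B | S3 \subset b]| = lambda) ->
    (forall b : {set T}, b \in B -> S \subset b -> #|b :&: D| = m) ->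
  (#|D| - 2) * lambda = (m - 2) * #|[set b in B | S \subset b]|.
Proof.
move=> cardS subSD design3 cardD; pose BS := [set b in B | S \subset b].
transitivity (\sum_(x in D :\: S) #|[set b in BS | x \in b]|).
  rewrite -cardS -cardsDS // -sum_nat_const; apply: eq_bigr => x /setDP[_ xS].
  rewrite -(design3 (x |: S)); last by rewrite cardsU1 xS cardS.
  by apply: eq_card => b; rewrite !inE subUset sub1set -andbA; congr (_ && _); rewrite andbC.
rewrite double_count mulnC -sum_nat_const; apply: eq_bigr => b; rewrite inE => /andP[bB Sb].
rewrite -(cardD b) // -cardS -cardsDS; last by rewrite subsetI Sb.
by apply: eq_card => x; rewrite !inE; case: (x \in S); rewrite //= andbC.
Qed.

(** * The iterated wreath product and its transitivity on pairs *)

Section Wreath.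

Variables (e : nat -> nat) (s : nat).
Local Notation point := (point e s).
Local Notation G := (iterated_wreath e s).
Implicit Types (x y z : point) (i : nat) (j : 'I_s).

(** Coordinates are 0-based, so the classes of [agree i] are the parts of C_i. *)
Definition agree i x y := [forall j : 'I_s, (i <= j) ==> (x j == y j)].
Definition class i x : {set point} := [set y | agree i x y].

Lemma agreeP i x y :
  reflect (forall j, i <= j -> x j = y j) (agree i x y).
Proof.
apply: (iffP forallP) => [xy j ij | xy j]; first by have /implyP/(_ ij)/eqP := xy j.
by apply/implyP => ij; rewrite xy.
Qed.

Lemma agree_refl i x : agree i x x. Proof. exact/agreeP. Qed.

Lemma agree_sym i x y : agree i x y = agree i y x.
Proof. by apply: eq_forallb => j; rewrite eq_sym. Qed.

Lemma agree_trans i : transitive (agree i).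
Proof. by move=> y x z /agreeP xy /agreeP yz; apply/agreeP => j ij; rewrite xy ?yz. Qed.

Lemma agree_equiv i : equivalence_rel (agree i).
Proof.
move=> x y z; split=> [|xy]; first exact: agree_refl.
by apply/idP/idP; apply: agree_trans => //; rewrite agree_sym.
Qed.

Lemma agree_leq i k x y : i <= k -> agree i x y -> agree k x y.
Proof. by move=> ik /agreeP xy; apply/agreeP => j kj; apply/xy/(leq_trans ik). Qed.

Lemma agree0 x y : agree 0 x y = (x == y).
Proof.
apply/agreeP/eqP => [xy | -> //]; apply/ffunP => j; exact: xy.
Qed.

Lemma agree_ge i x y : s <= i -> agree i x y.
Proof.
by move=> si; apply/agreeP => j ij; have := ltn_ord j; rewrite ltnNge (leq_trans si).
Qed.

Lemma agreeS j x y : agree j x y = (x j == y j) && agree j.+1 x y.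
Proof.
apply/agreeP/andP => [xy | [/eqP xyj /agreeP xy] k].
  by split; [rewrite xy | apply/agreeP => k /ltnW; exact: xy].
by rewrite leq_eqVlt => /predU1P[/val_inj <- // | ]; exact: xy.
Qed.

Lemma in_class i x y : (y \in class i x) = agree i x y.
Proof. by rewrite inE. Qed.

Lemma eq_class i x y : (class i x == class i y) = agree i x y.
Proof.
apply/eqP/idP => [xy | xy]; first by rewrite -in_class xy in_class agree_refl.
by apply/setP => z; rewrite !inE; exact: (agree_equiv i x y z).2.
Qed.

Lemma level_partitionE i : level_partition e s i = [set class i x | x : point].
Proof.
apply/setP => K; apply/imsetP/imsetP => -[x _ ->]; exists x => //;
  by apply/setP => y; rewrite !inE.
Qed.

(** The converse implication between agreements comes from applying invariance to the inverse of
    [g]. Levels beyond [s] are harmless, since all points agree there. *)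
Lemma wreathP (g : {perm point}) :
  reflect (forall i x y, agree i (g x) (g y) = agree i x y) (g \in G).
Proof.
have wreath_agree i x y (h : {perm point}) : h \in G -> agree i x y -> agree i (h x) (h y).
  have [si _ _ | si] := leqP s i; first exact: agree_ge.
  move=> /bigcapP/(_ (Ordinal (ltn_trans si (ltnSn s))) isT) /= /astabsP/(_ (class i x)).
  rewrite level_partitionE imset_f // => /imsetP[z _]; rewrite setact_imset => hz xy.
  have hin t : agree i x t -> agree i z (h t).
    by move=> xt; rewrite -in_class -hz imset_f // in_class.
  by apply: agree_trans (hin y xy); rewrite agree_sym hin ?agree_refl.
apply: (iffP idP) => [gG i x y | gA].
  apply/idP/idP; last exact: wreath_agree.
  by move/(wreath_agree _ _ _ _ (groupVr gG)); rewrite !permK.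
apply/bigcapP => i _; rewrite !inE /=; apply/subsetP => K; rewrite level_partitionE inE.
case/imsetP => x _ ->{K}; apply/imsetP; exists (g x) => //=.
rewrite setact_imset; apply/setP => y; rewrite in_class -[y in RHS](permKV g) gA.
by rewrite -{1}[y](permKV g) mem_imset ?in_class //; exact: perm_inj.
Qed.

(* A product of coordinate permutations, each allowed to depend on the higher
   coordinates, is invertible by downward induction on the coordinates. *)
Lemma wreath_coord (h : forall j : 'I_s, point -> {perm 'Z_(e j.+1)}) :
    (forall j x y, agree j.+1 x y -> h j x = h j y) ->
  exists2 g : {perm point}, g \in G & forall x j, g x j = h j x (x j).
Proof.
move=> h_agree; pose f x : point := finfun (fun j : 'I_s => h j x (x j)).
have fE x j : f x j = h j x (x j) by rewrite ffunE.
have f_agree i x y : agree i (f x) (f y) = agree i x y.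
  apply/agreeP/agreeP => xy j ij; last first.
    by rewrite !fE xy // (h_agree j x y) //; apply/agreeP => k /ltnW/(leq_trans ij); exact: xy.
  move: {2}_.+1 (ltnSn (s - j)) => n; elim: n j ij => // n IHn j ij ltn.
  apply: (@perm_inj _ (h j x)); rewrite [in RHS](h_agree j x y) -?fE ?xy //.
  apply/agreeP => k jk; apply: IHn; first exact: leq_trans (ltnW jk).
  by rewrite -ltnS; apply: leq_trans ltn; rewrite ltnS ltn_sub2l // (ltn_trans jk).
have f_inj : injective f by move=> x y /eqP; rewrite -agree0 f_agree agree0 => /eqP.
exists (perm f_inj) => [|x j]; last by rewrite permE fE.
by apply/wreathP => i x y; rewrite !permE.
Qed.

Lemma wreath_trans x y : exists2 g : {perm point}, g \in G & g x = y.
Proof.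
have [//|g gG gE] := @wreath_coord (fun j _ => tperm (x j) (y j)).
by exists g => //; apply/ffunP => j; rewrite gE tpermL.
Qed.

(* Move the [i]-th coordinate of [y] first; the lower ones are only moved where
   the [i]-th coordinate is that of [y], hence not at [x]. *)
Lemma wreath_trans2 (i : 'I_s) x y z :
    agree i.+1 x y -> agree i.+1 x z -> ~~ agree i x y -> ~~ agree i x z ->
  exists2 g : {perm point}, g \in G & g x = x /\ g y = z.
Proof.
move=> xy xz; rewrite !agreeS xy xz !andbT => nxy nxz.
pose h (j : 'I_s) (t : point) :=
  if (j == i) || (j < i) && (t i == y i) then tperm (y j) (z j) else 1%g.
have [j t u /agreeP tu|g gG gE] := @wreath_coord h.
  by rewrite /h; case: ltnP => // ji; rewrite tu.
exists g => //; split; apply/ffunP => j; rewrite gE /h.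
  rewrite (negPf nxy) andbF orbF; case: eqP => [->|_]; last by rewrite perm1.
  by rewrite tpermD // eq_sym.
rewrite eqxx andbT; case: ifP => [_|]; first by rewrite tpermL.
rewrite perm1 -leq_eqVlt => /negbT; rewrite -ltnNge => ij.
by rewrite -(agreeP _ _ _ xy) ?(agreeP _ _ _ xz).
Qed.

Lemma wreath_imset_class (g : {perm point}) i x : g \in G -> g @: class i x = class i (g x).
Proof.
move/wreathP => gG; apply/setP => y; rewrite -[y](permKV g).
by rewrite mem_imset ?in_class ?gG //; exact: perm_inj.
Qed.

End Wreath.

(** * The base block and the sizes of its parts *)

Section BaseBlock.

Variables (e : nat -> nat) (s p : nat).
Hypotheses (e_gt1 : forall i, 1 < e i.+1) (s_gt0 : 0 < s) (lt_p_e1 : p < e 1).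
Local Notation point := (point e s).
Local Notation G := (iterated_wreath e s).
Local Notation B0 := (base_block e s p).
Implicit Types (x y z : point) (i : nat) (l : 'I_s).

Definition origin : point := finfun (fun j : 'I_s => 0%R : 'Z_(e j.+1)).

Lemma originE (j : 'I_s) : origin j = 0%R. Proof. by rewrite ffunE. Qed.

Lemma axis_in l (d : 'Z_(e l.+1)) : axis_point d l = d.
Proof. by rewrite ffunE dfwith_in. Qed.

Lemma axis_out l (d : 'Z_(e l.+1)) (j : 'I_s) : l != j -> axis_point d j = 0%R.
Proof. by move=> lj; rewrite ffunE dfwith_out. Qed.

Lemma axis_point0 l : axis_point (0%R : 'Z_(e l.+1)) = origin.
Proof.
apply/ffunP => j; rewrite originE; have [<-|lj] := eqVneq l j; first exact: axis_in.
exact: axis_out.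
Qed.

Lemma axis_inj l : injective (@axis_point e s l).
Proof. by move=> c d cd; rewrite -[c]axis_in cd axis_in. Qed.

Lemma agree_axis i l (d : 'Z_(e l.+1)) :
  agree i origin (axis_point d) = (l < i) || (d == 0%R).
Proof.
apply/agreeP/orP => [od | od j ij]; last rewrite originE.
  by have [li|il] := ltnP l i; [left | right; rewrite -[d]axis_in -od // originE].
have [lj|lj] := eqVneq l j; last by rewrite axis_out.
subst j; rewrite axis_in; case: od => [|/eqP//].
by rewrite ltnNge ij.
Qed.

(** The origin already lies in the first union, so 0 may be allowed on the other axes too, which
    makes all axes but the first uniform. *)
Lemma base_blockP x :
  reflect (exists l (d : 'Z_(e l.+1)), (l == 0 :> nat -> d <= p) /\ x = axis_point d)
          (x \in B0).
Proof.
apply: (iffP setUP) => [[] /bigcupP[l l0 /imsetP[d dp ->]] | [l [d [dp ->]]]].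
- by exists l, d; split=> // _; rewrite inE in dp.
- by exists l, d; rewrite -leqn0 leqNgt l0.
have [l0|l0] := posnP l.
  left; apply/bigcupP; exists l; first by rewrite l0.
  by rewrite imset_f // inE dp // l0.
have [->|d0] := eqVneq d 0%R.
  left; apply/bigcupP; exists (Ordinal s_gt0) => //; rewrite axis_point0.
  by rewrite -(axis_point0 (Ordinal s_gt0)) imset_f // inE.
by right; apply/bigcupP; exists l => //; rewrite imset_f // inE.
Qed.

Definition block_part i := B0 :&: class i origin.

Lemma in_block_part i x : (x \in block_part i) = (x \in B0) && agree i origin x.
Proof. by rewrite inE in_class. Qed.

Lemma origin_in_part i : origin \in block_part i.
Proof.
rewrite in_block_part agree_refl andbT; apply/base_blockP.
by exists (Ordinal s_gt0), 0%R; rewrite axis_point0.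
Qed.

Lemma block_part_full : block_part s = B0.
Proof. by apply/setP => x; rewrite in_block_part agree_ge // andbT. Qed.

(** A point of B_s outside the C_i-class of the origin has its only nonzero coordinate at an index
    at least [i], so its C_i-class determines it. *)
Lemma base_block_agree i x y :
  x \in B0 -> y \in B0 -> agree i x y -> ~~ agree i origin x -> x = y.
Proof.
move=> /base_blockP[l [c [_ ->]]] /base_blockP[m [d [_ ->]]] /agreeP cd.
rewrite agree_axis negb_or -leqNgt => /andP[il c0].
have := cd l il; rewrite axis_in; have [/esym ml|ml] := eqVneq m l.
  by subst m; rewrite axis_in => ->.
by rewrite axis_out // => c0'; rewrite c0' eqxx in c0.
Qed.

Lemma block_part0 : block_part 0 = [set origin].
Proof.
apply/setP => x; rewrite in_block_part agree0 in_set1 eq_sym.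
by have [->|] := eqVneq; [rewrite -block_part_full origin_in_part | rewrite andbF].
Qed.

Lemma block_partS l : 0 < l ->
  block_part l.+1 = block_part l :|: [set axis_point d | d : 'Z_(e l.+1) in [set~ 0%R]].
Proof.
move=> l_gt0; apply/setP => x; rewrite in_setU !in_block_part.
apply/andP/orP => [[/base_blockP[m [d [dp ->]]]] | [/andP[-> ox] | /imsetP[d]]].
- rewrite !agree_axis ltnS leq_eqVlt; have [/val_inj lm|lm /=] := eqVneq (m : nat) l.
    subst m; rewrite ltnn /= => _.
    have [->|d0] := eqVneq d 0%R; last by right; rewrite imset_f // in_setC1.
    by left; rewrite andbT axis_point0 -block_part_full origin_in_part.
  by move=> md; left; rewrite md andbT; apply/base_blockP; exists m, d.
- by split=> //; apply: agree_leq ox.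
rewrite in_setC1 => d0 ->; rewrite agree_axis ltnSn; split=> //.
by apply/base_blockP; exists l, d; rewrite eqn0Ngt l_gt0.
Qed.

Lemma card_Z i : #|{: 'Z_(e i.+1)}| = e i.+1.
Proof. by rewrite card_ord Zp_cast. Qed.

Lemma block_part1 (l := Ordinal s_gt0) :
  block_part 1 = [set axis_point d | d : 'Z_(e l.+1) & d <= p].
Proof.
apply/setP => x; rewrite in_block_part; apply/andP/imsetP => [[] | [d dp ->]].
  case/base_blockP => m [d [dp ->]]; rewrite agree_axis ltnS leqn0 => md.
  have [m0|m0] := posnP m.
    have lm : l = m by apply: val_inj.
    by subst m; exists d; rewrite // inE dp.
  exists 0%R; rewrite ?inE // axis_point0.
  by move: md; rewrite eqn0Ngt m0 /= => /eqP->; rewrite axis_point0.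
rewrite agree_axis; split=> //; apply/base_blockP; exists l, d; split=> //.
by move: dp; rewrite inE.
Qed.

Lemma card_Z_leq l : l = 0 :> nat -> #|[set d : 'Z_(e l.+1) | d <= p]| = p.+1.
Proof.
move=> l0; have le_p : p.+1 <= (Zp_trunc (e l.+1)).+2 by rewrite Zp_cast ?l0.
rewrite -sum1dep_card -(eq_bigl _ _ (fun d : 'Z_(e l.+1) => ltnS d p)).
by rewrite (big_ord_narrow le_p) sum1_card card_ord.
Qed.

Lemma card_part1 : #|block_part 1| = p.+1.
Proof. by rewrite block_part1 card_imset ?card_Z_leq //; exact: axis_inj. Qed.

Lemma card_partS l : 0 < l -> #|block_part l.+1| = #|block_part l| + (e l.+1 - 1).
Proof.
move=> l_gt0; rewrite block_partS // cardsU disjoint_setI0 ?cards0 ?subn0.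
  rewrite card_imset; last exact: axis_inj.
  by rewrite cardsC1 card_Z subn1.
rewrite disjoint_sym disjoints_subset; apply/subsetP => _ /imsetP[d d0 ->].
by rewrite inE in_block_part agree_axis ltnn /=; rewrite in_setC1 in d0; rewrite (negPf d0) andbF.
Qed.

(** A class is a family of choices, one per coordinate: those below [i] are free, the others are
    pinned to the values of [x]. *)
Lemma card_class i x : i <= s -> #|class i x| = \prod_(1 <= j < i.+1) e j.
Proof.
move=> le_is; pose F (j : 'I_s) : pred 'Z_(e j.+1) := fun d => (i <= j) ==> (x j == d).
have -> : #|class i x| = #|(family F : simpl_pred point)|.
  by apply: eq_card => y; rewrite inE; apply/forallP/familyP => xy j; exact: xy.
rewrite card_family foldrE big_map big_enum /=.
rewrite (eq_bigr (fun j : 'I_s => if j < i then e j.+1 else 1)).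
  by rewrite -big_mkcond big_add1 /= big_mkord (big_ord_widen _ (fun j => e j.+1) le_is).
move=> j _; have [ij|ji] := leqP i j.
  by rewrite -[RHS](card1 (x j)); apply: eq_card => d; rewrite unfold_in /F ij eq_sym.
by rewrite -[RHS]card_Z; apply: eq_card => d; rewrite unfold_in /F leqNgt ji.
Qed.

(** Within B_s, a point of B_i agrees with exactly the points of B_i; by [base_block_agree], any
    other point agrees only with itself. *)
Lemma card_base_agree i :
  \sum_(x in B0) #|B0 :&: class i x| = #|block_part i| ^ 2 + (#|B0| - #|block_part i|).
Proof.
have sub_part : block_part i \subset B0 by exact: subsetIl.
rewrite (bigID (mem (block_part i))) /= -cardsDS //; congr (_ + _).
  rewrite (eq_bigr (fun=> #|block_part i|)) => [|x /andP[_]]; last first.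
    by rewrite in_block_part => /andP[_]; rewrite -eq_class => /eqP<-.
  rewrite sum_nat_const -mulnn; congr (_ * _).
  by apply: eq_card => x; apply/andb_idl/(subsetP sub_part).
rewrite -sum1_card; apply: eq_big => [x | x /andP[xB]]; first by rewrite in_setD andbC.
rewrite in_block_part xB /= => ox; rewrite -(cards1 x); apply: eq_card => y.
rewrite in_setI in_class in_set1; apply/andP/eqP => [[yB xy] | ->]; last by rewrite agree_refl.
exact/esym/(base_block_agree xB yB xy).
Qed.

(** * Orbits of the parts of the base block, and the number of blocks *)

Definition part_orbit i : {set {set point}} := orbit 'P^* G (block_part i).

Lemma part_orbitP i (A : {set point}) :
  reflect (exists2 g : {perm point}, g \in G & A = g @: block_part i) (A \in part_orbit i).
Proof. by apply: (iffP orbitP) => -[g gG gA]; exists g. Qed.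

(** Points of one C_1-class are told apart by their first coordinates. A permutation of the first
    factor carries {0,...,p} to the first coordinates of [A], and transpositions carry the other
    coordinates from 0 to those of the class. *)
Lemma part_orbit1P (A : {set point}) :
  reflect (#|A| = p.+1 /\ exists x, A \subset class 1 x) (A \in part_orbit 1).
Proof.
apply: (iffP (part_orbitP 1 A)) => [[g gG ->] | [cardA [x /subsetP xA]]].
  split; first by rewrite card_imset ?card_part1 //; exact: perm_inj.
  by exists (g origin); rewrite -wreath_imset_class // imsetS // subsetIr.
pose l := Ordinal s_gt0; pose A' := [set (y : point) l | y in A].
have cardA' : #|A'| = p.+1.
  rewrite card_in_imset // => y z /xA; rewrite in_class => xy /xA; rewrite in_class => xz yz.
  apply/eqP; rewrite -agree0 -[0]/(l : nat) agreeS yz eqxx /=.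
  by apply: agree_trans xz; rewrite agree_sym.
have [sigma sA] := perm_imset_ex (etrans (card_Z_leq (erefl : l = 0 :> nat)) (esym cardA')).
pose h (j : 'I_s) (_ : point) := dfwith (fun j => tperm 0%R (x j)) sigma j.
have [//|g gG gE] := @wreath_coord _ _ h.
exists g => //; apply/eqP; rewrite eqEcard cardA card_imset ?card_part1 ?leqnn ?andbT //;
  last exact: perm_inj.
apply/subsetP => y yA; have : y l \in A' by apply/imsetP; exists y.
rewrite -sA => /imsetP[d dp yl].
have -> : y = g (axis_point d).
  apply/ffunP => j; rewrite gE /h; have [lj|lj] := eqVneq l j.
    by subst j; rewrite dfwith_in axis_in.
  rewrite dfwith_out // axis_out // tpermL.
  move/xA: yA; rewrite in_class => /agreeP-> //.
  by rewrite lt0n eq_sym; apply: contra lj => /eqP j0; apply/eqP/val_inj.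
by rewrite imset_f // block_part1 imset_f.
Qed.

(** Double counting of the pairs [(x, A)] with [A] inside [class 1 x]: being nonempty, [A] lies in a
    single class, hence in that of exactly e_1 points. *)
Lemma card_part_orbit1 : #|part_orbit 1| * e 1 = #|{: point}| * 'C(e 1, p.+1).
Proof.
have card_class1 x : #|class 1 x| = e 1 by rewrite card_class // big_nat1.
rewrite -cardsT -[LHS]sum_nat_const -[RHS]sum_nat_const; apply/esym.
rewrite (eq_bigr (fun x => #|[set A in part_orbit 1 | A \subset class 1 x]|)).
  rewrite double_count; apply: eq_bigr => A /part_orbit1P[cardA [x xA]].
  rewrite -(card_class1 x); apply: eq_card => y; rewrite in_set in_setT in_class /=.
  have /card_gt0P[z zA] : 0 < #|A| by rewrite cardA.
  have /(subsetP xA) := zA; rewrite in_class => xz.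
  apply/idP/idP => [/subsetP/(_ z zA) | ]; last by rewrite -eq_class => /eqP<-.
  by rewrite in_class (agree_sym _ y); exact: agree_trans.
move=> x _; rewrite -(card_class1 x) -cards_draws.
apply: eq_card => A; rewrite !inE; apply/andP/andP => [[xA /eqP cA] | [/part_orbit1P[cA _] xA]].
  by split=> //; apply/part_orbit1P; split=> //; exists x.
by rewrite cA.
Qed.

Hypothesis p_gt0 : 0 < p.

(** If [g] moved a point of B_i out of the C_i-class of the origin, all of B_i would land in one
    other C_i-class, where B_s has at most one point; but B_i has at least p + 1 > 1 points. *)
Lemma stab_block_part i j (g : {perm point}) : 0 < i -> i <= j -> g \in G ->
  g @: block_part j = block_part j -> g @: block_part i = block_part i.
Proof.
move=> i_gt0 ij gG gj; apply/eqP; rewrite eqEcard card_imset ?leqnn ?andbT; last exact: perm_inj.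
have sub_ij : block_part i \subset block_part j.
  apply/subsetP => x; rewrite !in_block_part => /andP[-> /=]; exact: agree_leq.
have gB x : x \in block_part i -> g x \in B0.
  by move/(subsetP sub_ij)/(imset_f g); rewrite gj in_block_part => /andP[].
apply/subsetP => _ /imsetP[x xi ->]; rewrite in_block_part gB //=.
apply/negPn/negP => ogx.
have : #|block_part i| <= #|[set x]|.
  apply/subset_leq_card/subsetP => y yi; rewrite in_set1 eq_sym; apply/eqP/(@perm_inj _ g).
  apply: base_block_agree ogx; rewrite ?gB // (wreathP _ gG).
  move: xi yi; rewrite !in_block_part => /andP[_ ox] /andP[_]; apply: agree_trans.
  by rewrite agree_sym.
apply/negP; rewrite -ltnNge cards1; have := p_gt0; rewrite -ltnS -card_part1.
move/leq_trans; apply; apply/subset_leq_card/subsetP => y.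
by rewrite !in_block_part => /andP[-> /=]; exact: agree_leq.
Qed.


Definition part_stab i : {group {perm point}} := 'C_G[block_part i | 'P^*]%G.

Lemma part_stabP i (g : {perm point}) :
  reflect (g \in G /\ g @: block_part i = block_part i) (g \in part_stab i).
Proof.
by apply: (iffP setIP) => -[gG gi]; split=> //; [exact: (astab1P gi) | exact/astab1P].
Qed.

(** The C_l-classes inside the C_{l+1}-class of the origin are indexed by coordinate [l]. Index 0 is
    the class containing B_l; pinning its value to the origin keeps [f] total without affecting the
    count. *)
Definition transversals l : {set {ffun 'Z_(e l.+1) -> point}} :=
  [set f in family (fun d => if d == 0%R then [set origin] else class l (axis_point d))].

Lemma transversalsP l (f : {ffun 'Z_(e l.+1) -> point}) :
  reflect (f 0%R = origin /\ forall d, agree l (axis_point d) (f d)) (f \in transversals l).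
Proof.
rewrite inE; apply: (iffP familyP) => [fF | [f0 fa] d]; last first.
  by case: eqP => [-> | _]; rewrite ?inE ?f0 // in_class.
have f0 : f 0%R = origin by have := fF 0%R; rewrite eqxx => /set1P.
split=> // d; have := fF d; case: eqP => [-> _ | _]; last by rewrite in_class.
by rewrite f0 axis_point0 agree_refl.
Qed.

Lemma card_transversals l :
  #|transversals l| = (\prod_(1 <= j < l.+1) e j) ^ (e l.+1 - 1).
Proof.
rewrite cardsE card_family foldrE big_map big_enum /= (bigD1 0%R) //= cards1 mul1n.
rewrite (eq_bigr (fun=> \prod_(1 <= j < l.+1) e j)) => [|d /negPf->]; last first.
  by rewrite card_class // ltnW.
rewrite (eq_bigl (mem [set~ (0%R : 'Z_(e l.+1))])) => [|d]; last by rewrite /= in_setC1.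
by rewrite prod_nat_const cardsC1 card_Z subn1.
Qed.

Definition block_of_transversal l (f : {ffun 'Z_(e l.+1) -> point}) :=
  block_part l :|: f @: [set~ 0%R].

Lemma transversal_out l f d (x : point) : f \in transversals l ->
  x \in block_part l -> x = f d -> d = 0%R.
Proof.
case/transversalsP => _ /(_ d)/agreeP fd; rewrite in_block_part => /andP[_ /agreeP ox] xf.
by rewrite -[d]axis_in fd // -xf -ox // originE.
Qed.

Lemma block_of_transversal_inj l : {in transversals l &, injective (@block_of_transversal l)}.
Proof.
move=> f g fF gF fg; have [f0 fa] := transversalsP _ fF.
have [g0 ga] := transversalsP _ gF.
apply/ffunP => d; have [->|d0] := eqVneq d 0%R; first by rewrite f0 g0.
have : f d \in block_of_transversal f by rewrite inE imset_f ?orbT // in_setC1.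
rewrite fg => /setUP[/(transversal_out fF)/(_ erefl) d0' | /imsetP[c _ fgc]].
  by rewrite d0' eqxx in d0.
by rewrite fgc; congr (g _); rewrite -[c]axis_in -[d]axis_in (agreeP _ _ _ (ga c)) // (agreeP _ _ _ (fa d)) // fgc.
Qed.

Lemma part_stab_orbit l : 0 < l ->
  orbit 'P^* (part_stab l) (block_part l.+1)
    = @block_of_transversal l @: transversals l.
Proof.
move=> l_gt0; apply/setP => A; apply/orbitP/imsetP => [[g /part_stabP[gG gl] <-] | [f fF ->]].
  (* This is the action of [g] on the C_l-classes inside the C_{l+1}-class of the origin, read off
     coordinate [l]; it fixes 0 because [g] stabilises B_l. *)
  pose pi_ (d : 'Z_(e l.+1)) : 'Z_(e l.+1) := g (axis_point d) l.
  have gA i x y : agree i (g x) (g y) = agree i x y by apply/wreathP.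
  have agree_up (d : 'Z_(e l.+1)) : agree l.+1 origin (g (axis_point d)).
    have : g origin \in block_part l by rewrite -gl imset_f // origin_in_part.
    rewrite in_block_part => /andP[_ /(agree_leq (leqnSn l)) og].
    by apply: agree_trans og _; rewrite gA agree_axis ltnSn.
  have agree_pi d : agree l (axis_point (pi_ d)) (g (axis_point d)).
    rewrite agreeS axis_in eqxx /=; apply: agree_trans (agree_up d).
    by rewrite agree_sym agree_axis ltnSn.
  have pi_inj : injective pi_.
    move=> c d cd; have : agree l (g (axis_point c)) (g (axis_point d)).
      by apply: agree_trans (agree_pi d); rewrite -cd agree_sym.
    by rewrite gA => /agreeP/(_ l (leqnn _)); rewrite !axis_in.
  pose sigma := perm pi_inj.
  have sigma0 : sigma 0%R = 0%R.
    rewrite permE /pi_ axis_point0; have : g origin \in block_part l.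
      by rewrite -gl imset_f // origin_in_part.
    by rewrite in_block_part => /andP[_ /agreeP <-] //; rewrite originE.
  (* Image points are reindexed by the value of coordinate [l] they land on, hence the inverse of
     [sigma]. *)
  exists [ffun d => if d == 0%R then origin else g (axis_point (sigma^-1%g d))].
    apply/transversalsP; rewrite ffunE eqxx; split=> // d; rewrite ffunE.
    have [->|d0] := eqVneq d 0%R; first by rewrite axis_point0 agree_refl.
    by rewrite -{1}[d](permKV sigma) permE; exact: agree_pi.
  rewrite setact_imset block_partS // imsetU gl; congr (_ :|: _).
  apply/setP => x; apply/imsetP/imsetP => [[_ /imsetP[d d0 ->] ->] | [d d0 ->]].
    have sd0 : sigma d != 0%R by rewrite -{1}sigma0 (inj_eq perm_inj) -in_setC1.
    by exists (sigma d); rewrite ?in_setC1 // ffunE (negPf sd0) permK.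
  exists (axis_point (sigma^-1%g d)); last by rewrite ffunE -in_set1 -[_ \in _]negbK -in_setC d0.
  by rewrite imset_f // in_setC1 -(inj_eq (@perm_inj _ sigma)) permKV sigma0 -in_setC1.
have [f0 fa] := transversalsP _ fF.
(* Only coordinates below [l] move, by transpositions depending on coordinate [l]. Since [f] sends 0
   to the origin, these are trivial where that coordinate is 0, so B_l is fixed pointwise. *)
pose h (j : 'I_s) (x : point) := if j < l then tperm 0%R (f (x l) j) else 1%g.
have [j x y /agreeP xy | g gG gE] := @wreath_coord _ _ h.
  by rewrite /h; case: ltnP => // jl; rewrite xy.
have g_id x : x \in block_part l -> g x = x.
  rewrite in_block_part => /andP[_ /agreeP ox]; apply/ffunP => j.
  by rewrite gE /h -ox // originE f0 originE tperm1; case: ifP; rewrite perm1.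
have g_axis d : g (axis_point d) = f d.
  apply/ffunP => j; rewrite gE /h axis_in; case: ltnP => [jl | lj].
    by rewrite axis_out ?tpermL // eq_sym; apply: contraTneq jl => ->; rewrite ltnn.
  by rewrite perm1 (agreeP _ _ _ (fa d)).
have gl : g @: block_part l = block_part l.
  by rewrite (eq_in_imset (g := id)) ?imset_id // => x /g_id.
exists g; first exact/part_stabP.
rewrite setact_imset block_partS // imsetU gl -imset_comp; congr (_ :|: _).
exact/eq_imset/g_axis.
Qed.

(** The stabilisers are nested, so their indices multiply; the relative index is the size of the
    orbit described by [part_stab_orbit]. *)
Lemma card_part_orbitS l : 0 < l ->
  #|part_orbit l.+1| = #|part_orbit l| * (\prod_(1 <= j < l.+1) e j) ^ (e l.+1 - 1).
Proof.
move=> l_gt0; rewrite -card_transversals -(card_in_imset (@block_of_transversal_inj l)).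
rewrite -part_stab_orbit // !card_orbit.
have sub_stab : part_stab l.+1 \subset part_stab l.
  apply/subsetP => g /part_stabP[gG gl]; apply/part_stabP; split=> //.
  exact: stab_block_part gl.
have -> : 'C_(part_stab l)[block_part l.+1 | 'P^*]%g = part_stab l.+1.
  apply/setP => g; apply/setIP/idP => [[/part_stabP[gG _] /astab1P gl] | gl].
    exact/part_stabP.
  by split; [exact: (subsetP sub_stab) | apply/astab1P; have /part_stabP[] := gl].
by rewrite Lagrange_index ?subsetIl.
Qed.

Lemma card_part_orbit i : i < s ->
  #|part_orbit i.+1| = #|part_orbit 1|
    * \prod_(1 <= j < i.+1) (\prod_(1 <= k < j.+1) e k) ^ (e j.+1 - 1).
Proof.
elim: i => [|i IHi] lt_is; first by rewrite big_nil ?big_geq // muln1.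
rewrite (card_part_orbitS (l := Ordinal lt_is)) // IHi ?(ltnW lt_is) //.
by rewrite [in RHS]big_nat_recr //= mulnA.
Qed.

(** * Blocks through a pair of points *)

Local Notation blocks := (base_block_orbit e s p).

Lemma blocksP (A : {set point}) :
  reflect (exists2 g : {perm point}, g \in G & A = g @: B0) (A \in blocks).
Proof. by apply: (iffP orbitP) => -[g gG gA]; exists g. Qed.

Lemma imset_blocks (g : {perm point}) b : g \in G -> b \in blocks -> g @: b \in blocks.
Proof.
move=> gG /blocksP[h hG ->]; apply/blocksP; exists (h * g)%g; first exact: groupM.
by rewrite -imset_comp; apply: eq_imset => x; rewrite /= permM.
Qed.

(** The factor [e 1] on the left avoids writing the number v / e_1 of classes of C_1 as a
    quotient. *)
Lemma card_blocks :
  #|blocks| * e 1 = #|{: point}| * 'C(e 1, p.+1)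
    * \prod_(2 <= i < s.+1) (\prod_(1 <= k < i) e k) ^ (e i - 1).
Proof.
rewrite -card_part_orbit1 mulnAC big_add1 /=; congr (_ * _).
have -> : blocks = part_orbit s by rewrite /part_orbit block_part_full.
by have := @card_part_orbit s.-1; rewrite prednK // leqnn => ->.
Qed.

Definition pair_degree x y := #|[set b in blocks | (x \in b) && (y \in b)]|.

Lemma pair_degree_act (g : {perm point}) x y :
  g \in G -> pair_degree (g x) (g y) = pair_degree x y.
Proof.
have le_act h z t : h \in G -> pair_degree z t <= pair_degree (h z) (h t).
  move=> hG; rewrite /pair_degree -(card_imset _ (imset_inj (@perm_inj _ h))).
  apply/subset_leq_card/subsetP => _ /imsetP[b bP ->]; move: bP.
  by rewrite !inE => /and3P[bO zb tb]; rewrite imset_blocks ?imset_f.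
move=> gG; apply/anti_leq; rewrite le_act // andbT.
by rewrite -{2}[x](permK g) -{2}[y](permK g) le_act ?groupV.
Qed.

Definition agree_pairs i : {set point * point} := [set u | agree i u.1 u.2].

Lemma card_agree_pairs i :
  i <= s -> #|agree_pairs i| = #|{: point}| * \prod_(1 <= j < i.+1) e j.
Proof.
move=> le_is; rewrite /agree_pairs (card_pairs predT (agree i)) /=.
by rewrite (eq_bigr _ (fun x _ => card_class x le_is)) sum_nat_const.
Qed.

(** Counted block by block: elements of [G] preserve agreement, so every block contributes as much
    as B_s. Diagonal pairs are included. *)
Lemma sum_pair_degree i :
  \sum_(u in agree_pairs i) pair_degree u.1 u.2
    = #|blocks| * (#|block_part i| ^ 2 + (#|B0| - #|block_part i|)).
Proof.
rewrite double_count -sum_nat_const; apply: eq_bigr => _ /blocksP[g gG ->].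
rewrite -card_base_agree.
pose gg (u : point * point) := (g u.1, g u.2).
have gg_inj : injective gg by move=> [x y] [z t] [/perm_inj-> /perm_inj->].
have -> : [set u in agree_pairs i | (u.1 \in g @: B0) && (u.2 \in g @: B0)]
    = gg @: [set u | (u.1 \in B0) && (u.2 \in B0 :&: class i u.1)].
  apply/setP => u; apply/idP/imsetP => [| [[x y] xyP ->]].
    rewrite in_set /= in_set => /and3P[u12 /imsetP[x xB ux] /imsetP[y yB uy]]; exists (x, y).
      by rewrite in_set /= in_setI in_class xB yB /= -(wreathP _ gG) -ux -uy.
    by case: u ux uy {u12} => /= _ _ -> ->.
  rewrite in_set /= in_setI in_class in xyP; case/and3P: xyP => xB yB xy.
  by rewrite in_set /= in_set /= (wreathP _ gG) xy !imset_f.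
rewrite card_imset // (card_pairs (mem B0) (fun x y => y \in B0 :&: class i x)).
by apply: eq_bigr => x _; apply: eq_card => y; rewrite in_set.
Qed.

Lemma level_ex x y : x != y ->
  exists l, agree l.+1 x y /\ ~~ agree l x y.
Proof.
rewrite -agree0 => xy; have : exists i, agree i x y by exists s; exact: agree_ge.
case/ex_minnP => -[|i] xyi min_i; first by rewrite xyi in xy.
have nxyi : ~~ agree i x y by apply/negP => /min_i; rewrite ltnn.
by have [si|lt_is] := leqP s i; [rewrite agree_ge in nxyi | exists (Ordinal lt_is)].
Qed.

(* [block_part_sq] says that the fraction of the pairs agreeing from coordinate
   [i] on which lie in the base block does not depend on [i]. *)
Hypothesis block_part_sq : forall i, i <= s ->
  #|block_part i| ^ 2 + (#|B0| - #|block_part i|)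
    = \prod_(1 <= j < i.+1) e j + (#|B0| - 1).

(** Let [l] be the level separating [x] from [y]. Subtracting the sums of [sum_pair_degree] at
    levels l + 1 and l leaves the pairs separated at [l], on which the degree is constant. By
    [block_part_sq] each block contains c_{l+1} - c_l of them, out of v times as many. *)
Lemma pair_degreeE x y : x != y -> #|{: point}| * pair_degree x y = #|blocks|.
Proof.
case/level_ex => l [xyS xyl].
pose v := #|{: point}|; pose cl := \prod_(1 <= j < l.+1) e j.
have subS : agree_pairs l \subset agree_pairs l.+1.
  by apply/subsetP => u; rewrite !inE; exact: agree_leq.
have cE : \prod_(1 <= j < l.+2) e j = cl * e l.+1 by rewrite big_nat_recr.
have cardD : #|agree_pairs l.+1 :\: agree_pairs l| = v * (cl * (e l.+1 - 1)).
  by rewrite cardsDS // !card_agree_pairs ?(ltnW (ltn_ord l)) // cE -mulnBr [in RHS]mulnBr muln1.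
have := sum_pair_degree l.+1; rewrite (big_setID (agree_pairs l)) /= (setIidPr subS).
rewrite sum_pair_degree (eq_bigr (fun=> pair_degree x y)); last first.
  (* First [x] is moved to [z], then the image of [y] to [t] with [z] fixed. *)
  move=> [z t]; rewrite !inE /= => /andP[ztl ztS].
  have [g gG gxz] := wreath_trans x z; rewrite -gxz in ztS ztl *.
  rewrite -(pair_degree_act x y gG); have /wreathP gA := gG.
  have [||||h hG [hx <-]] := @wreath_trans2 _ _ l (g x) (g y) t _ _ _ _; rewrite ?gA //.
  by rewrite -{1}hx pair_degree_act.
rewrite sum_nat_const cardD !block_part_sq ?(ltnW (ltn_ord l)) // cE -/cl.
have e_l := e_gt1 l; have cl_gt0 : 0 < cl by rewrite /cl big_add1; apply: prodn_gt0 => j; exact: ltnW.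
have <- : cl + cl * (e l.+1 - 1) = cl * e l.+1.
  by rewrite -[X in X + _]muln1 -mulnDr subnKC // ltnW.
rewrite addnAC [RHS]mulnDr => /addnI.
rewrite [LHS]mulnAC [v * _ * _]mulnC [RHS]mulnC => /eqP.
by rewrite eqn_pmul2l ?muln_gt0 ?cl_gt0 ?subn_gt0 // => /eqP.
Qed.

Lemma card_blocks_gt0 : 0 < #|blocks|.
Proof. by apply/card_gt0P; exists B0; exact: orbit_refl. Qed.

(** Pulled back to B_s, two distinct points sharing a C_1-class must lie in the class of the origin,
    where B_s has p + 1 points. *)
Lemma card_block_class1 b x y : b \in blocks ->
  x \in b -> y \in b -> x != y -> agree 1 x y -> #|b :&: class 1 x| = p.+1.
Proof.
case/blocksP => g gG -> /imsetP[z zB ->] /imsetP[t tB ->].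
rewrite (inj_eq (@perm_inj _ g)) (wreathP _ gG) => zt ztA.
rewrite -(wreath_imset_class _ _ gG) -imsetI; last by move=> ? ? _ _; exact: perm_inj.
rewrite card_imset; last exact: perm_inj.
have [oz|noz] := boolP (agree 1 origin z).
  by move: oz; rewrite -eq_class => /eqP<-; exact: card_part1.
by rewrite (base_block_agree zB tB ztA noz) eqxx in zt.
Qed.

(** * Block-transitivity, chain-imprimitivity and failure of flag-transitivity *)

Lemma wreath_block_transitive :
  G \subset design_aut blocks /\ block_transitive G blocks.
Proof. by split; [exact/acts_orbit/subsetT | exact: atrans_orbit]. Qed.

Lemma wreath_chain_imprimitive : chain_imprimitive s G.
Proof.
split.
  apply/imsetP; exists origin => //; apply/setP => x; rewrite in_setT; apply/esym/orbitP.
  by have [g gG gx] := wreath_trans origin x; exists g.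
have levelP i x : class i x \in level_partition e s i.
  by rewrite level_partitionE imset_f.
exists (level_partition e s); split=> [i le_is | i lt_is | |].
- apply/andP; split.
    by apply: equivalence_partitionP => x y z _ _ _; exact: agree_equiv.
  exact: (bigcap_inf (Ordinal (le_is : i < s.+1))).
- split=> [A | ].
    rewrite level_partitionE => /imsetP[x _ ->]; exists (class i.+1 x) => //.
    by apply/subsetP => y; rewrite !in_class; exact: agree_leq.
  exists (class i origin), (class i.+1 origin); split=> //.
  pose l := Ordinal lt_is; apply/properP; split.
    by apply/subsetP => y; rewrite !in_class; exact: agree_leq.
  exists (axis_point (1%R : 'Z_(e l.+1))); rewrite in_class agree_axis ?ltnSn //.
  by rewrite /= ltnn oner_eq0.
- rewrite level_partitionE; apply: eq_imset => x.
  by apply/setP => y; rewrite in_class agree0 in_set1 eq_sym.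
rewrite level_partitionE; apply/setP => A; rewrite in_set1.
have classT x : class s x = [set: point] by apply/setP => y; rewrite in_class agree_ge ?in_setT.
apply/imsetP/eqP => [[x _ ->] // | ->]; by exists origin.
Qed.

(** An element fixing B_s and sending the origin to [x], on the second axis, would carry [y], in the
    C_1-class of the origin, into the C_1-class of [x], whose only point in B_s is [x]. *)
Lemma not_wreath_flag_transitive : 1 < s -> ~~ flag_transitive G blocks.
Proof.
move=> s_gt1; pose l := Ordinal s_gt1; pose m := Ordinal s_gt0.
pose x := axis_point (1%R : 'Z_(e l.+1)); pose y := axis_point (1%R : 'Z_(e m.+1)).
have xB : x \in B0 by apply/base_blockP; exists l, 1%R.
have yB : y \in B0 by apply/base_blockP; exists m, 1%R; split=> // _; rewrite /= modn_small.
have oB : origin \in B0 by rewrite -block_part_full origin_in_part.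
have flagB z : z \in B0 -> (z, B0) \in flags blocks.
  by move=> zB; rewrite inE /= zB andbT; exact: orbit_refl.
apply/negP => tr; have [g gG [gx gB]] := atransP2 tr (flagB _ oB) (flagB _ xB).
have gin z : z \in B0 -> g z \in B0 by move=> zB; rewrite gB imset_f.
have oy : agree 1 (g origin) (g y) by rewrite (wreathP _ gG) agree_axis.
have nox : ~~ agree 1 origin (g origin) by rewrite -gx agree_axis oner_eq0.
have /perm_inj/(congr1 (fun z : point => z m)) := base_block_agree (gin _ oB) (gin _ yB) oy nox.
by rewrite originE axis_in => /esym/eqP; rewrite oner_eq0.
Qed.

End BaseBlock.

(** * Arithmetic of the factors *)

Lemma expn_exp2S p i : p ^ (2 ^ i.+1) = (p ^ (2 ^ i)) ^ 2.
Proof. by rewrite -expnM -expnSr. Qed.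

Lemma factorSS p i : factor p i.+2 = p ^ (2 ^ i.+1) - p ^ (2 ^ i) + 1.
Proof. by rewrite /factor /= !subn1 subn2. Qed.

Lemma factor_gt1 p i : 1 < p -> 1 < factor p i.+1.
Proof.
case: i => [|i] p_gt1; first by rewrite /factor /=; lia.
by rewrite factorSS addn1 ltnS subn_gt0 ltn_exp2l // ltn_exp2l.
Qed.

(* With [r = p ^ (2 ^ i)]: [(r^2 + r + 1) (r^2 - r + 1) = r^4 + r^2 + 1]. *)
Lemma prod_factor p i : 0 < p ->
  \prod_(1 <= j < i.+2) factor p j = (p ^ (2 ^ i)) ^ 2 + p ^ (2 ^ i) + 1.
Proof.
move=> p_gt0; elim: i => [|i IHi]; first by rewrite big_nat1 /factor /= expn1.
rewrite big_nat_recr //= IHi factorSS !expn_exp2S.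
have : 0 < p ^ (2 ^ i) by rewrite expn_gt0 p_gt0.
by move: (p ^ (2 ^ i)) => r r_gt0; have [t ->] : exists t, r = t.+1 by [exists r.-1; lia]; nia.
Qed.

(** The increments e_j - 1, differences of consecutive repeated squares of p, telescope from the
    initial size p + 1. *)
Lemma card_block_part_factor p s i : 1 < p -> i < s ->
  #|block_part (factor p) s p i.+1| = p ^ (2 ^ i) + 1.
Proof.
move=> p_gt1; have s_gt0 : i < s -> 0 < s by exact: leq_ltn_trans.
have lt_p : p < factor p 1 by rewrite /factor /=; lia.
elim: i s_gt0 => [|i IHi] s_gt0 lt_is; have {}s_gt0 := s_gt0 lt_is.
  rewrite card_part1 //; first by rewrite expn1 addn1.
  by move=> i; exact: factor_gt1.
have -> := @card_partS _ s p (fun j => factor_gt1 j p_gt1) s_gt0 (Ordinal lt_is) isT.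
rewrite IHi ?(ltnW lt_is) //= factorSS.
have : p ^ (2 ^ i) <= p ^ (2 ^ i.+1) by rewrite leq_pexp2l ?leq_pexp2l // ltnW.
lia.
Qed.

(* Eliminating the unknowns from the two equations leaves
   [(p - 1) (q - 1) (q - p) = q - p]. *)
Lemma design3_contra p q lambda lambda3 :
    1 < p -> p ^ 2 <= q -> 0 < lambda ->
    (q ^ 2 + q + 1 - 2) * lambda3 = (q + 1 - 2) * lambda ->
    (p ^ 2 + p + 1 - 2) * lambda3 = (p.+1 - 2) * lambda -> False.
Proof.
case: p q => [|a] [|b] // a_gt0 le_ab lambda_gt0.
have -> : b.+1 ^ 2 + b.+1 + 1 - 2 = b ^ 2 + 3 * b + 1 by lia.
have -> : b.+1 + 1 - 2 = b by lia.
have -> : a.+1 ^ 2 + a.+1 + 1 - 2 = a ^ 2 + 3 * a + 1 by lia.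
rewrite subn2 /= => eqb eqa.
have eq_ab : b * (a ^ 2 + 3 * a + 1) = a * (b ^ 2 + 3 * b + 1).
  apply/eqP; rewrite -(eqn_pmul2r lambda_gt0) mulnAC -eqb [X in _ == X]mulnAC -eqa.
  by apply/eqP; ring.
have lt_ab : a < b by nia.
have [t bE] : exists t, b = a + t.+1 by exists (b - a).-1; lia.
by move: eq_ab; rewrite bE; nia.
Qed.

Theorem theorem4p6 (p s : nat) (hp : 2 <= p) (hs : 2 <= s) :
  let q := p ^ (2 ^ (s - 1)) in
  let e := factor p in
  let c := class_size p in
  let G := iterated_wreath e s in
  let B := base_block_orbit e s p in
  [/\ exists2 lambda : nat,
        (lambda%:R = 'C(e 1%N - 1, p)%:R * (1 / (p + 1)%:R)
                     * \prod_(2 <= i < s.+1) (c (i - 1)%N)%:R ^+ (e i - 1)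
           :> rat)%R
        & is_design 2 (q ^ 2 + q + 1) (q + 1) lambda B,
      ~ is_t_design 3 B,
      G \subset design_aut B /\ block_transitive G B,
      chain_imprimitive s G
    & ~~ flag_transitive G B].
Proof.
move=> q e c G B.
have p_gt0 : 0 < p by exact: ltnW.
have s_gt0 : 0 < s by exact: ltnW.
have e_gt1 i : 1 < e i.+1 by exact: factor_gt1.
have e1E : e 1 = p ^ 2 + p + 1 by [].
have lt_p_e1 : p < e 1 by rewrite e1E; lia.
have cardB0 : #|base_block e s p| = q + 1.
  rewrite -block_part_full /q; case: (s) s_gt0 => // s' _.
  by rewrite card_block_part_factor // subn1.
have cardv : #|{: point e s}| = q ^ 2 + q + 1.
  rewrite -cardsT -(_ : class s (origin e s) = setT); last first.
    by apply/setP => x; rewrite in_class agree_ge ?in_setT.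
  by rewrite card_class // /q; case: (s) s_gt0 => // s' _; rewrite prod_factor // subn1.
have block_part_sq i : i <= s ->
  #|block_part e s p i| ^ 2 + (#|base_block e s p| - #|block_part e s p i|)
    = \prod_(1 <= j < i.+1) e j + (#|base_block e s p| - 1).
  case: i => [_|i lt_is]; first by rewrite block_part0 // cards1 big_geq.
  (* With r = p^(2^i) this is (r + 1)^2 + (q - r) = (r^2 + r + 1) + q; the bound r <= q keeps the
     subtraction exact. *)
  rewrite prod_factor // card_block_part_factor // cardB0.
  have : p ^ (2 ^ i) <= q by rewrite /q !leq_pexp2l //; lia.
  lia.
(* The pair defining [lambda] is taken inside one class of C_1, so that it can serve again against
   the 3-design property. *)
pose l := Ordinal s_gt0; pose x := origin e s; pose y := axis_point (1%R : 'Z_(e l.+1)).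
have xy : x != y by rewrite -agree0 agree_axis oner_eq0.
pose lambda := #|[set b in B | [set x; y] \subset b]|.
have lambdaE (S : {set point e s}) : #|S| = 2 -> (q ^ 2 + q + 1) * #|[set b in B | S \subset b]| = #|B|.
  move=> /eqP/cards2P[z [t [zt ->]]].
  rewrite -cardv.
  rewrite -(pair_degreeE e_gt1 s_gt0 block_part_sq zt); congr (_ * _).
  by apply: eq_card => b; rewrite !inE subUset !sub1set.
have cardxy : #|[set x; y]| = 2 by rewrite cards2 xy.
have lambda_gt0 : 0 < lambda.
  have := card_blocks_gt0 e s p; rewrite -[base_block_orbit _ _ _]/B -(lambdaE _ cardxy).
  by rewrite muln_gt0 => /andP[].
have card_block b : b \in B -> #|b| = q + 1.
  by case/blocksP => g _ ->; rewrite card_imset ?cardB0 //; exact: perm_inj.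
split.
- exists lambda; last first.
    split=> // S cardS; apply/eqP; rewrite -(eqn_pmul2l (m := q ^ 2 + q + 1)) ?addn1 //.
    by rewrite -addn1 !lambdaE.
  have := card_blocks e_gt1 s_gt0 lt_p_e1 p_gt0.
  rewrite -[base_block_orbit _ _ _]/B -(lambdaE _ cardxy) cardv.
  set P := \prod_(2 <= i < s.+1) _ => cardP.
  have lambdaP : lambda * (p + 1) = 'C(e 1 - 1, p) * P.
    apply/eqP; rewrite -(eqn_pmul2l (m := (q ^ 2 + q + 1) * e 1)); last first.
      by rewrite muln_gt0 addn1 /= ltnW.
    (* The identity e_1 C(e_1 - 1, p) = (p + 1) C(e_1, p + 1) accounts for both e_1 and the division
       by p + 1. *)
    have binE := mul_bin_diag (e 1) p; rewrite -subn1 -(addn1 p) in binE.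
    apply/eqP; transitivity ((q ^ 2 + q + 1) * P * ((p + 1) * 'C(e 1, p + 1))).
      by rewrite mulnACA mulnA cardP -(addn1 p); ring.
    by rewrite -binE; ring.
  have PE : (P%:R = \prod_(2 <= i < s.+1) (c (i - 1)%N)%:R ^+ (e i - 1) :> rat)%R.
    rewrite natr_prod; apply: eq_big_nat => -[|[|i]] // _.
    by rewrite natrX /c /class_size !subn1.
  rewrite -PE div1r mulrAC -natrM -lambdaP natrM mulfK // Num.Theory.pnatr_eq0.
  by rewrite addn1.
- case=> _ [_] [l3 [_ _ design3]].
  have subC : [set x; y] \subset class 1 x.
    by rewrite subUset !sub1set !in_class agree_refl agree_axis.
  (* Third points are counted first in the whole set, where a block has q + 1 points, then in
     [class 1 x], where a block through the pair has p + 1. *)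
  have eqT : (q ^ 2 + q + 1 - 2) * l3 = (q + 1 - 2) * lambda.
    rewrite -cardv -cardsT; apply: design3_count => // b bB _.
    by rewrite setIT card_block.
  have eqC : (p ^ 2 + p + 1 - 2) * l3 = (p.+1 - 2) * lambda.
    have <- : #|class 1 x| = p ^ 2 + p + 1 by rewrite card_class // big_nat1.
    apply: design3_count => // b bB; rewrite subUset !sub1set => /andP[xb yb].
    by apply: (card_block_class1 _ _ _ bB xb yb xy) => //; rewrite agree_axis.
  have le_q : p ^ 2 <= q.
    by rewrite /q leq_pexp2l // -{1}(expn1 2) leq_pexp2l // subn_gt0.
  exact: (design3_contra hp le_q lambda_gt0 eqT eqC).
- exact: wreath_block_transitive.
- exact: wreath_chain_imprimitive.
exact: not_wreath_flag_transitive.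
Qed.
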